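(* Let $n \geq 1$, let $C$ be a conjugacy class in $SL(n+1, \mathbf{k})$ and let $w \in S_{n+1}$ be an involution. Then $C \cap (BwB) \neq \emptyset$ if and only if $l_2(w) \leq l(C)$.
   Context: $\mathbf{k}$ is an algebraically closed field. $B$ is the subgroup of upper-triangular matrices in $SL(n+1,\mathbf{k})$ and $H$ the subgroup of diagonal matrices. The Weyl group $N_G(H)/H$ of $G = SL(n+1,\mathbf{k})$ is identified with the permutation group $S_{n+1}$ of $\{1,\dots,n+1\}$ (a representative $\dot w$ of $w$ is a monomial matrix whose nonzero entries are in positions $(w(i), i)$), and $BwB = B\dot{w}B$. An involution is an element $w$ with $w^2=1$ (the identity is allowed). For $w\in S_{n+1}$, $l_2(w) = |\{i \in [1,n+1] : w(i) > i\}|$; for an involution this is the number of $2$-cycles in its cycle decomposition. For a conjugacy class $C$ in $SL(n+1,\mathbf{k})$ and any $g \in C$, $r(C) = \min\{\operatorname{rank}(g - cI_{n+1}) : c \in \mathbf{k}\}$, where $I_{n+1}$ is the identity matrix, and $l(C) = \min\left\{r(C), \left[\frac{n+1}{2}\right]\right\}$, where $[x]$ is the largest integer $\leq x$. *)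

(* Defs.v *)
From mathcomp Require Import all_boot all_order all_fingroup all_algebra.
From mathcomp Require Import boolp classical_sets.

Set Implicit Arguments.
Unset Strict Implicit.
Unset Printing Implicit Defensive.

Import GRing.Theory.
Local Open Scope classical_set_scope.
Local Open Scope ring_scope.

Section Defs.

Variables (k : closedFieldType) (m : nat).
Implicit Types (g h b : 'M[k]_m) (w : 'S_m) (C : set 'M[k]_m).

Definition SL : set 'M[k]_m := [set g | \det g = 1].

Definition borel : set 'M[k]_m :=
  [set b | SL b /\ forall i j : 'I_m, (j < i)%N -> b i j = 0].

Definition SL_class g : set 'M[k]_m := [set h *m g *m invmx h | h in SL].

Definition is_SL_class C : Prop := exists2 g, SL g & C = SL_class g.

Definition weyl_rep w : set 'M[k]_m :=
  [set d | SL d /\ forall i j : 'I_m, (d i j != 0) = (i == w j)].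

(* All representatives of w are allowed; by [bruhat_cellE] below the double
   coset does not depend on which one is used. *)
Definition bruhat_cell w : set 'M[k]_m :=
  [set x | exists b1 d b2,
     [/\ borel b1, weyl_rep w d, borel b2 & x = b1 *m d *m b2]].

Definition l2 w : nat := #|[set i : 'I_m | (i < w i)%N]%SET|.

Lemma scalar_rank_ex g :
  exists r, `[< exists c : k, \rank (g - c%:M) = r >].
Proof. by exists (\rank (g - 0%:M)); apply/asboolP; exists 0. Qed.

Definition min_rank g : nat := ex_minn (scalar_rank_ex g).

(* [xget 0 C] is some element of C; by [class_rE] below any other element
   gives the same value. *)
Definition class_r C : nat := min_rank (xget 0 C).

Definition class_l C : nat := minn (class_r C) m./2.

Lemma SL_unit g : SL g -> g \in unitmx.
Proof. by rewrite unitmxE => ->; rewrite unitr1. Qed.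

Lemma min_rank_conj g h : h \in unitmx ->
  min_rank (h *m g *m invmx h) = min_rank g.
Proof.
move=> hU; have rkE c : \rank (h *m g *m invmx h - c%:M) = \rank (g - c%:M).
  have -> : h *m g *m invmx h - c%:M = h *m (g - c%:M) *m invmx h.
    by rewrite mulmxBr mulmxBl scalar_mxC -[X in _ = _ - X]mulmxA mulmxV ?mulmx1.
  rewrite mxrankMfree ?row_free_unit ?unitmx_inv //.
  by rewrite eqmxMfull ?row_full_unit.
rewrite /min_rank; case: ex_minnP => a /asboolP[c ca] amin.
case: ex_minnP => b /asboolP[d db] bmin; apply/eqP; rewrite eqn_leq.
apply/andP; split; [apply: amin | apply: bmin]; apply/asboolP.
  by exists d; rewrite rkE.
by exists c; rewrite -rkE.
Qed.

Lemma class_rE C g : is_SL_class C -> C g -> class_r C = min_rank g.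
Proof.
move=> [g0 _ ->{C}] Cg; rewrite /class_r.
case: (xgetPex 0 (ex_intro _ g Cg)) => h hSL <-; case: Cg => h' h'SL <-.
by rewrite !min_rank_conj //; apply: SL_unit.
Qed.

Lemma weyl_rep_diag w d d' : weyl_rep w d -> weyl_rep w d' ->
  exists2 t, borel t & d' = d *m t.
Proof.
move=> [dSL dE] [d'SL d'E].
pose t := diag_mx (\row_j (d' (w j) j / d (w j) j)).
have dt : d' = d *m t.
  apply/matrixP => i j; rewrite mul_mx_diag !mxE.
  have := dE i j; have := d'E i j; case: (eqVneq i (w j)) => [-> _ n0|_].
    by rewrite mulrC divfK.
  by move=> /negbFE/eqP -> /negbFE/eqP ->; rewrite mul0r.
exists t => //; split; last first.
  by move=> i j ji; rewrite !mxE -val_eqE /= gtn_eqF.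
by move: d'SL; rewrite /SL /= dt det_mulmx dSL mul1r.
Qed.

Lemma borelM b b' : borel b -> borel b' -> borel (b *m b').
Proof.
move=> [bS bT] [b'S b'T]; split; first by rewrite /SL /= det_mulmx bS b'S mul1r.
move=> i j ji; rewrite mxE big1 // => l _.
case: (ltnP l i) => li; first by rewrite bT // mul0r.
by rewrite b'T ?mulr0 // (leq_trans ji).
Qed.

Lemma bruhat_cellE w d : weyl_rep w d ->
  bruhat_cell w = [set b.1 *m d *m b.2 | b in borel `*` borel].
Proof.
move=> dw; apply/seteqP; split => x /=.
  move=> [b1 [d' [b2 [B1 d'w B2 ->]]]].
  have [t tB ->] := weyl_rep_diag dw d'w.
  by exists (b1, t *m b2); rewrite /= ?mulmxA //; split => //; apply: borelM.
by move=> [[b1 b2] [/= B1 B2] <-]; exists b1, d, b2.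
Qed.

End Defs.

Lemma weyl_rep_ex (k : closedFieldType) (n : nat) (w : 'S_n.+1) :
  exists d : 'M[k]_n.+1, weyl_rep w d.
Proof.
pose u : 'rV[k]_n.+1 := \row_j (if j == ord0 then (-1) ^+ (w^-1)%g else 1).
exists (perm_mx w^-1 *m diag_mx u); split.
  rewrite /SL /= det_mulmx det_perm det_diag (bigD1 ord0) //= big1 => [|j j0].
    by rewrite mxE eqxx mulr1 -signr_addb addbb.
  by rewrite mxE (negbTE j0).
move=> i j; rewrite mul_mx_diag !mxE mulf_eq0 negb_or.
have -> : ((if j == ord0 then (-1) ^+ (w^-1)%g else 1) != 0 :> k).
  by case: ifP => _; rewrite ?oner_eq0 // signr_eq0.
rewrite andbT (canF_eq (permK w^-1)) invgK.
by case: (i == w j); rewrite /= ?oner_eq0 ?eqxx.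
Qed.

(* Main.v *)
Require Import Defs.
From mathcomp Require Import all_boot all_order all_fingroup all_algebra.
From mathcomp Require Import boolp classical_sets.
From mathcomp Require Import zify ring.

Set Implicit Arguments.
Unset Strict Implicit.
Unset Printing Implicit Defensive.

Import GRing.Theory.
Local Open Scope ring_scope.

(** Two matrices are handled as conjugate through an intertwining equation
    [h *m g = L *m h] with [h] invertible.  Since the field is algebraically
    closed, any invertible [h] can be rescaled to determinant one, so [SL]-classes
    are stable under such conjugations ([SL_class_conj]).

    Necessity of the rank bound.  An element of [BwB] is conjugate to [b *m d]
    with [b] upper triangular and [d] a representative of [w].  In
    [b *m d - c%:M], keep the rows [t] with [w t < t] and the columns [w t] for
    the same [t].  This submatrix is upper triangular with nonzero diagonal, the
    scalar part landing strictly above the diagonal, whence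
    [l2 w <= \rank (g - c%:M)] for every [c] ([l2_le_rank]).  The bound by half
    of the size holds for every involution ([excedances_le_half]).

    Sufficiency.  An element of [SL] lies in [BwB] as soon as its column [j]
    vanishes below row [w j]; this is [bruhat_pattern].  If [s] is the
    transposition of the adjacent indices [i] and [i'], and the involution [w]
    satisfies [w i < w i'] without fixing both, the double cosets of [s], [w] and
    [s] multiply to that of [s * w * s], so a conjugate with the pattern of [w]
    yields one with the pattern of [s * w * s] ([bruhat_pattern_step]).  Every
    involution is reached by such steps from one with [w i <= i.+1] for all [i],
    that is, a product of disjoint adjacent transpositions ([involution_ind]), and
    the steps preserve [l2].

    For a product of [k] disjoint adjacent transpositions one needs a [g]-stable
    partial flag whose steps have dimension 1 or 2, in a prescribed order with [k]
    steps of dimension 2, and [g] not scalar on those: a vector that is cyclic for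
    the plane then produces the zeros of the pattern
    ([adjacent_involution_form]).  The flag is built by induction, passing to the
    quotient by its first step [U].  Writing [k] for the number of planes still
    needed, the bound required of the quotient follows from
    [k <= \rank (g - c%:M)] as soon as [U] is not contained in the image of
    [g - c%:M] for those [c] where this rank equals [k].  Such a line exists when
    the dimension is larger than [2 * k] ([eigenvector_outside]), and such a plane
    when it is at least [2 * k] ([cyclic_plane_outside]).  The reason in both cases
    is that the kernel of [g - c%:M], for such a [c], is at least as large as its
    image.  Matrices act on row vectors here, so this is carried out for the
    transpose of [g]. *)

(** * Conjugation and stable subspaces *)

Section LinearAlgebra.

Variable F : fieldType.

Lemma mxrank_conj m (h g L : 'M[F]_m) c : h \in unitmx ->
  h *m g = L *m h -> \rank (L - c%:M) = \rank (g - c%:M).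
Proof.
move=> hU hg; have <- : \rank ((L - c%:M) *m h) = \rank (L - c%:M).
  by rewrite mxrankMfree ?row_free_unit.
have -> : (L - c%:M) *m h = h *m (g - c%:M).
  by rewrite mulmxBr mulmxBl hg scalar_mxC.
by rewrite eqmxMfull ?row_full_unit.
Qed.

(** An eigenvector for [c] is only rescaled by [g - c'%:M], so it lies in the image
    of that matrix. *)
Lemma kermx_sub_eigen m (g : 'M[F]_m) c c' : c != c' ->
  (kermx (g - c%:M) <= g - c'%:M)%MS.
Proof.
move=> cc'; have cc'0 : c - c' != 0 by rewrite subr_eq0.
apply/submxP; exists ((c - c')^-1 *: kermx (g - c%:M)).
have -> : g - c'%:M = (g - c%:M) + (c - c')%:M.
  by rewrite raddfB /= addrA subrK.
by rewrite -scalemxAl mulmxDr mulmx_ker add0r mul_mx_scalar scalerA mulVf ?scale1r.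
Qed.

Lemma row_free_complete p q (U : 'M[F]_(p, p + q)) : row_free U ->
  exists2 h : 'M_(p + q), h \in unitmx & usubmx h = U.
Proof.
move=> Ufree; exists (block_mx (col_ebase U) 0 0 1%:M *m row_ebase U).
  rewrite unitmx_mul row_ebase_unit andbT unitmxE det_ublock det1 mulr1 -unitmxE.
  exact: col_ebase_unit.
have rkU : \rank U = p by apply/eqP.
rewrite -[block_mx _ _ _ _]/(col_mx (row_mx _ _) (row_mx _ _)) mul_col_mx col_mxKu.
by rewrite -[X in _ = X]mulmx_ebase rkU pid_mx_row mul_mx_row mulmx1 mulmx0.
Qed.

(** The block [g'] is the action of [g] on the quotient by the stable space [U], so
    the image of [g' - c%:M] is that of [g - c%:M] taken modulo [U]. *)
Lemma conj_block p q (g : 'M[F]_(p + q)) (U : 'M_(p, p + q)) a :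
    row_free U -> U *m g = a *m U ->
  exists2 h : 'M_(p + q), h \in unitmx & exists b g',
    h *m g = block_mx a 0 b g' *m h /\
    forall c, (\rank (U + (g - c%:M)%R) <= p + \rank (g' - c%:M)%R)%N.
Proof.
move=> Ufree Ug; have [h hU hE] := row_free_complete Ufree.
exists h => //; set L := h *m g *m invmx h.
have Lh : h *m g = L *m h by rewrite /L mulmxKV.
have Uh : U = row_mx 1%:M 0 *m h.
  by rewrite -[h]vsubmxK mul_row_col mul1mx mul0mx addr0 hE.
have Lu : usubmx L = row_mx a 0.
  apply: (row_free_inj (A := h)); rewrite ?row_free_unit //.
  rewrite mul_usub_mx -Lh -mul_usub_mx hE Ug {1}Uh mulmxA mul_mx_row.
  by rewrite mulmx1 mulmx0.
have LE : L = block_mx a 0 (dlsubmx L) (drsubmx L).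
  by rewrite -[LHS]vsubmxK Lu /block_mx /dlsubmx /drsubmx hsubmxK.
exists (dlsubmx L), (drsubmx L); rewrite -LE; split=> // c.
have hfull : row_full h by rewrite row_full_unit.
have hfree : row_free h by rewrite row_free_unit.
rewrite -(adds_eqmx (eqmx_refl _) (eqmxMfull (g - c%:M) hfull)).
rewrite mulmxBr Lh scalar_mxC -mulmxBl Uh -addsmxMr mxrankMfree // LE.
move: (dlsubmx L) (drsubmx L) => b g'; rewrite block_mxKdr.
rewrite (scalar_mx_block p q) opp_block_mx add_block_mx !oppr0 !addr0.
rewrite -[X in (_ <= X + _)%N](mxrank1 F p) -rank_diag_block_mx.
apply: mxrankS; rewrite addsmx_sub; apply/andP; split.
  by apply/submxP; exists (row_mx 1%:M 0); rewrite mul_row_block !mul1mx !mul0mx !addr0.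
apply/submxP; exists (block_mx (a - c%:M) 0 b 1%:M).
by rewrite mulmx_block !mulmx1 !mul1mx !mul0mx !mulmx0 !addr0 !add0r.
Qed.

(** A change of basis in the quotient lifts to the whole space. *)
Lemma conj_block_corner p q (h g : 'M[F]_(p + q)) a b (g' h' L' : 'M_q) :
    h \in unitmx -> h *m g = block_mx a 0 b g' *m h ->
    h' \in unitmx -> h' *m g' = L' *m h' ->
  exists2 H, H \in unitmx & exists b', H *m g = block_mx a 0 b' L' *m H.
Proof.
move=> hU hg h'U h'g'.
have kU : (block_mx 1%:M 0 0 h' : 'M[F]_(p + q)) \in unitmx.
  by rewrite unitmxE det_ublock det1 mul1r -unitmxE.
exists (block_mx 1%:M 0 0 h' *m h); first by rewrite unitmx_mul kU.
exists (h' *m b); rewrite -mulmxA hg !mulmxA; congr (_ *m _).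
rewrite !mulmx_block !mulmx1 !mul1mx !mul0mx !mulmx0 !addr0 !add0r.
by rewrite h'g'.
Qed.

Lemma ltn_rank_adds p q m k (U : 'M[F]_(p, m)) (A : 'M_(q, m)) :
    (k <= \rank A)%N -> (\rank A = k -> ~~ (U <= A)%MS) ->
  (k < \rank (U + A))%N.
Proof.
rewrite leq_eqVlt => /predU1P[-> /(_ erefl) UA | kA _]; last first.
  by rewrite (leq_trans kA) // mxrankS // addsmxSr.
have : (A < U + A)%MS by rewrite ltmxE addsmxSr addsmx_sub submx_refl andbT.
by rewrite ltmxErank => /andP[].
Qed.

End LinearAlgebra.

(** * Stable lines and planes outside the critical images *)

Section Eigen.

Variable F : closedFieldType.

Lemma stable_eigenvector p m (g : 'M[F]_m) (V : 'M_(p, m)) :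
    stablemx V g -> V != 0 ->
  exists a (z : 'rV_m), [/\ z != 0, (z <= V)%MS & z *m g = a *: z].
Proof.
move=> Vg V0; have : stablemx (row_base V) g.
  by rewrite (eqmx_stable _ (eq_row_base V)).
case/submxP => A AE; have /closed_rootP[a] : size (char_poly A) != 1%N.
  by rewrite size_char_poly eqSS mxrank_eq0.
rewrite -eigenvalue_root_char => /eigenvalueP[v vA v0].
exists a, (v *m row_base V); split.
- apply: contraNneq v0 => v0; apply/eqP.
  by apply: (row_free_inj (row_base_free V)); rewrite v0 mul0mx.
- by rewrite -(eq_row_base V) submxMl.
- by rewrite -mulmxA AE mulmxA vA scalemxAl.
Qed.


(** If the coset [y + ker N] lay inside [W], then [W] would contain [ker N]; being
    no larger, it would equal [ker N], and then [y] would be killed by [N]. *)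
Lemma kermx_coset_avoid p m (W : 'M[F]_(p, m)) (N : 'M_m) (y : 'rV_m) :
    y *m N != 0 -> (\rank W <= \rank (kermx N))%N ->
  exists2 y', y' *m N = y *m N & ~~ (y' <= W)%MS.
Proof.
move=> yN0 rkW; have [yW | yW] := boolP (y <= W)%MS; last by exists y.
have /row_subPn[i iW] : ~~ (kermx N <= W)%MS.
  apply/negP => kW; have [_ /esym] := mxrank_leqif_sup kW.
  rewrite eqn_leq mxrankS //= rkW => Wk.
  by move/negP: yN0; apply; apply/eqP/sub_kermxP/(submx_trans yW).
exists (row i (kermx N) + y); last first.
  by apply: contra iW => iyW; rewrite -(addrK y (row i _)) addmx_sub ?eqmx_opp.
by rewrite mulmxDl -row_mul mulmx_ker row0 add0r.
Qed.

(** For a critical [c], meaning one where the rank is [k], the kernel of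
    [g - c%:M] has dimension [m - k > k], so it is not contained in the image.  There
    is only one critical [c], because its kernel is contained in the image of
    [g - c'%:M] for every other [c'], whose rank therefore exceeds [k]. *)
Lemma eigenvector_outside m k (g : 'M[F]_m) :
    (k.*2 < m)%N -> (forall c, (k <= \rank (g - c%:M)%R)%N) ->
  exists a (z : 'rV_m), [/\ z != 0, z *m g = a *: z &
    forall c, \rank (g - c%:M) = k -> ~~ (z <= g - c%:M)%MS].
Proof.
move=> km kg; have [[c rc] | noc] := EM (exists c, \rank (g - c%:M) = k).
  have /row_subPn[i iN] : ~~ (kermx (g - c%:M) <= g - c%:M)%MS.
    by apply/negP => /mxrankS; rewrite mxrank_ker rc; lia.
  exists c, (row i (kermx (g - c%:M))); split.
  - by apply: contraNneq iN => ->; rewrite sub0mx.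
  - apply/eqP; rewrite -subr_eq0 -mul_mx_scalar -mulmxBr.
    by rewrite -row_mul mulmx_ker row0.
  move=> c' rc'; have [<- // | cc'] := eqVneq c c'.
  by have := mxrankS (kermx_sub_eigen g cc'); rewrite mxrank_ker rc rc'; lia.
have [||a [z [z0 _ zg]]] := @stable_eigenvector m m g 1%:M.
- by rewrite submx1.
- by rewrite -mxrank_eq0 mxrank1; lia.
by exists a, z; split=> // c rc; case: noc; exists c.
Qed.

(** Put [N := g - c%:M] for an eigenvalue [c] of [g], a critical one (rank [k]) if
    there is any.  The nonzero stable space [im N] contains an eigenvector [z] of
    [g], and [z = y *m N] for a vector [y] that may be changed by any element of
    [ker N].  The plane
    spanned by [y] and [z] is stable, and [y] is cyclic in it as soon as [y] is not
    a multiple of [z]; choosing [y] outside [im N] when [c] is critical also keeps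
    the plane out of that image.  For another critical [c'], the image of
    [g - c'%:M] has dimension [k] and contains [ker N], of dimension [m - k >= k]:
    the two agree, and [y] is not in [ker N]. *)
Lemma cyclic_plane_outside m k (g : 'M[F]_m) :
    (0 < k)%N -> (k.*2 <= m)%N -> (forall c, (k <= \rank (g - c%:M)%R)%N) ->
  exists (y : 'rV_m) s t, [/\ row_free (col_mx (y *m g) y),
    y *m g *m g = s *: (y *m g) + t *: y &
    forall c, \rank (g - c%:M) = k -> ~~ (col_mx (y *m g) y <= g - c%:M)%MS].
Proof.
move=> k0 km kg.
have [c [kerN cP]] : exists c, (0 < \rank (kermx (g - c%:M)%R))%N /\
    forall c', \rank (g - c'%:M) = k -> \rank (g - c%:M) = k.
  have [[c rc] | noc] := EM (exists c, \rank (g - c%:M) = k).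
    by exists c; split=> //; rewrite mxrank_ker rc; lia.
  have [||a [z [z0 _ zg]]] := @stable_eigenvector m m g 1%:M.
  - by rewrite submx1.
  - by rewrite -mxrank_eq0 mxrank1; lia.
  exists a; split=> [|c' rc']; last by case: noc; exists c'.
  apply: leq_trans (_ : (\rank z <= _)%N); first by rewrite rank_rV z0.
  by apply/mxrankS/sub_kermxP; rewrite mulmxBr zg mul_mx_scalar subrr.
set N := g - c%:M in kerN cP.
have gE : g = N + c%:M by rewrite subrK.
have [||a [z [z0 /submxP[y0 y0N] zg]]] := @stable_eigenvector m m g N.
- by apply/submxP; exists g; rewrite /N mulmxBr mulmxBl scalar_mxC.
- by rewrite -mxrank_eq0; have := kg c; rewrite -/N; lia.
(* [y] has to avoid [im N] if [c] is critical, and the line of [z] in any case;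
   [z] lies in [im N], so that one subspace [W] serves both purposes. *)
have [W [zW rkW WN]] : exists W : 'M_m,
    [/\ (z <= W)%MS, (\rank W <= \rank (kermx N))%N & \rank N = k -> W = N].
  have [rk | /eqP nrk] := eqVneq (\rank N) k.
    by exists N; split=> //; [rewrite y0N submxMl | rewrite mxrank_ker rk; lia].
  by exists <<z>>%MS; split=> //; rewrite genmxE // rank_rV z0.
have [|y yN yW] := @kermx_coset_avoid _ m W N y0 _ rkW; first by rewrite -y0N.
have yg : y *m g = z + c *: y by rewrite gE mulmxDr yN -y0N mul_mx_scalar.
exists y, (a + c), (- (a * c)); split.
- rewrite -row_leq_rank yg; set S := col_mx _ _.
  have yS : (y <= S)%MS.
    by apply/submxP; exists (row_mx 0 1%:M); rewrite mul_row_col mul0mx mul1mx add0r.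
  have zS : (z <= S)%MS.
    apply/submxP; exists (row_mx 1%:M (- c)%:M).
    by rewrite mul_row_col mul1mx mul_scalar_mx scaleNr addrK.
  have : (z < S)%MS.
    by rewrite ltmxE zS; apply: contra yW => /(submx_trans yS)/submx_trans; apply.
  by rewrite ltmxErank rank_rV z0 => /andP[].
- rewrite yg mulmxDl zg -scalemxAl yg.
  by apply/rowP => i; rewrite !mxE; ring.
move=> c' rc'; have rN := cP c' rc'; apply/negP.
rewrite col_mx_sub => /andP[_ yc']; have [cc' | cc'] := eqVneq c c'.
  by move: yW; rewrite (WN rN) /N cc' yc'.
have kerc' := kermx_sub_eigen g cc'.
have [_ /esym] := mxrank_leqif_sup kerc'; rewrite -/N mxrank_ker rN rc'.
have -> : (m - k == k)%N by move: (mxrankS kerc'); rewrite mxrank_ker -/N rN rc'; lia.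
move=> subker; move: z0; rewrite y0N -yN; case/eqP.
exact/sub_kermxP/(submx_trans yc').
Qed.

End Eigen.

(** * Normal form for disjoint adjacent transpositions *)

Section NormalForm.

Lemma excedances_le_half m (h : 'I_m -> 'I_m) : involutive h ->
  ((\sum_(i < m) (i < h i)%N).*2 <= m)%N.
Proof.
move=> hK; have -> : ((\sum_(i < m) (i < h i)%N).*2 =
    \sum_(i < m) ((i < h i)%N + (h i < i)%N))%N.
  rewrite big_split /= -addnn; congr addn.
  by rewrite [RHS](reindex_inj (inv_inj hK)); apply: eq_bigr => i _; rewrite hK.
rewrite -[X in (_ <= X)%N]card_ord -sum1_card; apply: leq_sum => i _.
by case: ltngtP.
Qed.

Lemma block_zero_pattern (R : nzRingType) p q (f f' : nat -> nat)
    (a : 'M[R]_p) (b : 'M_(q, p)) (L : 'M_q) :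
    (forall i, f (p + i)%N = (p + f' i)%N) ->
    (forall i j : 'I_p, (f i < j)%N -> a i j = 0) ->
    (forall i j : 'I_q, (f' i < j)%N -> L i j = 0) ->
  forall i j : 'I_(p + q), (f i < j)%N -> block_mx a 0 b L i j = 0.
Proof.
move=> fE aP LP i j; case: (split_ordP i) => i' ->; case: (split_ordP j) => j' -> /=.
- by rewrite block_mxEul; apply: aP.
- by rewrite block_mxEur mxE.
- by rewrite fE; have := ltn_ord j'; lia.
- by rewrite block_mxEdr fE ltn_add2l; apply: LP.
Qed.

Variable F : closedFieldType.

(** The involution is a function on [nat] so that the first step of the flag can be
    dropped by shifting it, without transporting between permutation groups.
    Since [f i <= i.+1], either [f 0 = 0] and a line is removed, or [f] exchanges
    [0] and [1] and a plane is removed.  For the plane with basis [y *m g] and [y],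
    the row of [y] is [(1, 0)]; its second entry is the zero required by
    [f 1 = 0]. *)
Lemma adjacent_involution_form m (f : nat -> nat) (g : 'M[F]_m) :
    involutive f -> (forall i, (f i <= i.+1)%N) ->
    (forall i, (i < m)%N -> (f i < m)%N) ->
    (forall c, (\sum_(i < m) (i < f i)%N <= \rank (g - c%:M)%R)%N) ->
  exists2 h : 'M_m, h \in unitmx & exists2 L, h *m g = L *m h &
    forall i j : 'I_m, (f i < j)%N -> L i j = 0.
Proof.
elim/ltn_ind: m f g => -[|m] IH f g fK fS fm rkg.
  by exists 1%:M; rewrite ?unitmx1 //; exists g; [rewrite mul1mx mulmx1 | case].
have half p (u : nat -> nat) : involutive u ->
    (forall i, (i < p)%N -> (u i < p)%N) -> ((\sum_(i < p) (i < u i)%N).*2 <= p)%N.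
  move=> uK up; apply: (@excedances_le_half p (fun i => Ordinal (up i (ltn_ord i)))).
  by move=> i; apply: val_inj; rewrite /= uK.
have f0 : f 0 = 0 \/ f 0 = 1 by have := fS 0; lia.
set k := (\sum_(i < m.+1) _)%N in rkg.
case: f0 => f0.
  have fpos i : (0 < f i.+1)%N.
    by rewrite lt0n; apply/eqP => E; have := fK i.+1; rewrite E f0.
  pose f' i := (f i.+1).-1.
  have f'K : involutive f' by move=> i; rewrite /f' prednK // fK.
  have f'S i : (f' i <= i.+1)%N by rewrite /f'; have := fS i.+1; lia.
  have f'm i : (i < m)%N -> (f' i < m)%N.
    by rewrite /f' => im; have := fm i.+1 im; have := fpos i; lia.
  have kE : k = (\sum_(i < m) (i < f' i)%N)%N.
    rewrite /k big_ord_recl /= f0 add0n; apply: eq_bigr => i _.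
    by rewrite /f' /bump /= add1n -{1}(prednK (fpos i)).
  have [|a [z [z0 zg zP]]] := @eigenvector_outside F m.+1 k g _ rkg.
    by rewrite kE ltnS half.
  have [||h hU [b [g' [hg rkg']]]] := @conj_block F 1 m g z a%:M.
  - by rewrite -row_leq_rank rank_rV z0.
  - by rewrite zg mul_scalar_mx.
  have [c|h' h'U [L' h'g' L'P]] := IH m (leqnn _) f' g' f'K f'S f'm.
    rewrite -kE -ltnS -add1n; apply: leq_trans (rkg' c).
    by apply: ltn_rank_adds; [apply: rkg | apply: zP].
  have [H HU [b' Hg]] := conj_block_corner hU hg h'U h'g'.
  exists H => //; exists (block_mx a%:M 0 b' L') => //.
  apply: (@block_zero_pattern F 1 m f f') => // [i | i j].
    by rewrite !add1n /f' prednK.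
  by rewrite !ord1 f0.
have f1 : f 1 = 0 by rewrite -f0 fK.
case: m => [|m] in IH g fm k rkg *; first by have := fm 0 isT; rewrite f0.
have fgt i : (1 < f i.+2)%N.
  by case E : (f i.+2) (fK i.+2) => [|[|l]] //; rewrite ?f0 ?f1.
pose f' i := (f i.+2).-2.
have f'E i : f i.+2 = (f' i).+2 by rewrite /f'; have := fgt i; lia.
have f'K : involutive f' by move=> i; rewrite /f' -f'E fK.
have f'S i : (f' i <= i.+1)%N by have := fS i.+2; rewrite f'E.
have f'm i : (i < m)%N -> (f' i < m)%N.
  by move=> im; have := fm i.+2 im; rewrite f'E.
have kE : k = (\sum_(i < m) (i < f' i)%N).+1.
  rewrite /k 2!big_ord_recl /= f0 f1 add0n add1n; congr _.+1; apply: eq_bigr => i _.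
  by rewrite /bump /= !add1n f'E.
have [||y [s [t [yfree yg yP]]]] := @cyclic_plane_outside F m.+2 k g _ _ rkg.
- by rewrite kE.
- by rewrite kE doubleS !ltnS half.
pose a : 'M[F]_(1 + 1) := block_mx s%:M t%:M 1%:M 0.
have [||h hU [b [g' [hg rkg']]]] := @conj_block F (1 + 1) m g (col_mx (y *m g) y) a => //.
  rewrite mul_col_mx yg /a mul_block_col !mul_scalar_mx scale1r mul0mx addr0 //.
have [c|h' h'U [L' h'g' L'P]] := IH m (leqnSn _) f' g' f'K f'S f'm.
  rewrite -(leq_add2l 2) add2n -kE; apply: leq_trans (rkg' c).
  by apply: ltn_rank_adds; [apply: rkg | apply: yP].
have [H HU [b' Hg]] := conj_block_corner hU hg h'U h'g'.
exists H => //; exists (block_mx a 0 b' L') => //.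
apply: (@block_zero_pattern F 2 m f f') => // i j.
case: (@split_ordP 1 1 i) => i' ->; case: (@split_ordP 1 1 j) => j' ->;
  rewrite !ord1 /= ?f0 ?f1 // => _.
by apply: etrans (block_mxEdr (s%:M : 'M[F]_1) t%:M 1%:M 0 ord0 ord0) _; rewrite mxE.
Qed.

End NormalForm.

(** * Membership in a Bruhat cell by vanishing of entries *)

Section BruhatPattern.

(** For invertible [g], this says that [g] is a product [b *m d] with [b] upper
    triangular and [d] a monomial matrix of shape [w]. *)
Definition bruhat_pattern (R : nzRingType) m (w : 'S_m) (g : 'M[R]_m) :=
  forall i j : 'I_m, (w j < i)%N -> g i j = 0.

Lemma bruhat_pattern_cell (k : closedFieldType) n (w : 'S_n.+1) (g : 'M[k]_n.+1) :
  SL g -> bruhat_pattern w g -> bruhat_cell w g.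
Proof.
move=> gS gw; have [d dw] := weyl_rep_ex k w; have [dS dE] := dw.
pose b := \matrix_(i, j) (g i ((w^-1)%g j) / d j ((w^-1)%g j)).
have gE : g = b *m d.
  apply/matrixP => i j; rewrite mxE (bigD1 (w j)) //= big1 ?addr0 => [|l lw].
    by rewrite mxE permK divfK // dE.
  by move: (dE l j); rewrite (negbTE lw) => /negbFE/eqP->; rewrite mulr0.
exists b, d, 1%:M; rewrite mulmx1; split=> //.
  split; first by move: gS; rewrite /SL /= gE det_mulmx dS mulr1.
  by move=> i j ji; rewrite mxE gw ?mul0r // permKV.
split; first by rewrite /SL /= det1.
by move=> i j ji; rewrite mxE -val_eqE /= gtn_eqF.
Qed.

(** Permuting the columns by [w] makes [g] upper triangular with these entries on the
    diagonal. *)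
Lemma bruhat_pattern_pivot (F : fieldType) m (w : 'S_m) (g : 'M[F]_m) j :
  g \in unitmx -> bruhat_pattern w g -> g (w j) j != 0.
Proof.
move=> gU gw; pose B := (col_perm (w^-1)%g g)^T.
have Btrig : is_trig_mx B.
  by apply/is_trig_mxP => a b ab; rewrite !mxE gw // permKV.
have : B \in unitmx by rewrite unitmx_tr col_permE unitmx_mul gU unitmx_perm.
rewrite unitmxE det_trig // unitfE prodf_seq_neq0 => /allP/(_ (w j)).
by rewrite mem_index_enum !mxE permK; apply.
Qed.

(** Conjugating by [tperm i i'] moves every entry to an allowed place except the
    entry [(i, j)] just above the pivot [(i', j)], where [w j = i'].  That entry is
    cleared beforehand by subtracting a multiple of row [i'] from row [i].  The
    compensating operation adds a multiple of column [i] to column [i'], which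
    keeps the pattern because [w i < w i'], and reaches the cleared entry only if
    [w] fixes [i'], where what is added vanishes: [w] does not fix [i], so
    [w i < i] and column [i] is zero from row [i] on. *)
Lemma bruhat_pattern_step (F : fieldType) m (w : 'S_m) (i i' : 'I_m) (g : 'M[F]_m) :
    i' = i.+1 :> nat -> (w i < w i')%N -> ~ (w i = i /\ w i' = i') ->
    g \in unitmx -> bruhat_pattern w g ->
  exists2 h, h \in unitmx &
  exists2 L, h *m g = L *m h & bruhat_pattern (tperm i i' * w * tperm i i')%g L.
Proof.
move=> ii' wii' nfix gU gw; set s := tperm i i'.
have ni : i' != i by rewrite -val_eqE /= ii' gtn_eqF.
pose j := (w^-1)%g i'; have wj : w j = i' by rewrite permKV.
pose t := g i j / g i' j.
have tE : t * g i' j = g i j by rewrite divfK // -wj bruhat_pattern_pivot.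
pose E x : 'M[F]_m := 1%:M + x *: delta_mx i i'.
have EK x : E (- x) *m E x = 1%:M.
  rewrite /E mulmxDl mul1mx mulmxDr mulmx1 -scalemxAl -scalemxAr mul_delta_mx_cond.
  by rewrite (negbTE ni) mulr0n !scaler0 addr0 scaleNr addrK.
pose P : 'M[F]_m := perm_mx s.
have PK : P *m P = 1%:M by rewrite -perm_mxM tperm2 perm_mx1.
pose L1 := E (- t) *m g *m E t.
have EgE a b : (E (- t) *m g) a b = g a b - (a == i)%:R * t * g i' b.
  rewrite mulmxDl mul1mx -scalemxAl !mxE (bigD1 i') //= big1 => [|l li'].
    by rewrite !mxE eqxx andbT addr0; ring.
  by rewrite !mxE (negbTE li') andbF mul0r.
have L1E a b : L1 a b = (E (- t) *m g) a b + (b == i')%:R * t * (E (- t) *m g) a i.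
  rewrite /L1; move: (E (- t) *m g) => M.
  rewrite mulmxDr mulmx1 -scalemxAr mxE [in X in _ + X]mxE [in X in _ + X]mxE.
  rewrite (bigD1 i) //= big1 => [|l li]; last by rewrite mxE (negbTE li) mulr0.
  by rewrite mxE eqxx addr0 /=; ring.
(* [L1] still has the pattern of [w], and in addition vanishes at [(i, j)]. *)
have L1w : bruhat_pattern w L1.
  move=> a b wba; rewrite L1E !EgE gw // sub0r.
  have -> : (a == i)%:R * t * g i' b = 0.
    by have [ai | _] := eqVneq a i; rewrite ?mul0r // gw ?mulr0 // ii' -ai ltnW.
  have [bi' | _] := eqVneq b i'; last by rewrite !mul0r oppr0 addr0.
  rewrite bi' in wba; rewrite (gw a i) ?(ltn_trans wii') //.
  have [ai | _] := eqVneq a i; last by rewrite !mul0r; ring.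
  by rewrite (gw i' i); [ring | rewrite ai in wba; lia].
have L1ij : L1 i j = 0.
  rewrite L1E !EgE eqxx mul1r tE subrr add0r.
  have [ji' | _] := eqVneq j i'; last by rewrite !mul0r.
  rewrite ji' in wj; have wi : (w i < i)%N.
    have : (w i != i :> nat) by apply/eqP => /val_inj wi; apply: nfix.
    by move: wii'; rewrite wj ii'; lia.
  by rewrite !gw //; [ring | rewrite ii'; lia].
exists (P *m E (- t)).
  by rewrite unitmx_mul unitmx_perm; case: (mulmx1_unit (EK t)).
exists (P *m L1 *m P).
  have EK' : E t *m E (- t) = 1%:M by rewrite -{1}[t]opprK EK.
  by rewrite -!mulmxA (mulmxA P P) PK mul1mx EK' mulmx1.
have LE a b : (P *m L1 *m P) a b = L1 (s a) (s b).
  have -> : P *m L1 *m P = col_perm s (row_perm s L1).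
    by rewrite col_permE row_permE tpermV.
  by rewrite !mxE.
move=> a b; rewrite !permM LE -{1}[a](tpermK i i') -/s.
move: (s a) (s b) => a' b' lt; case: (ltnP (w b') a') => [|le]; first exact: L1w.
have [a'E wb'] : a' = i /\ w b' = i'.
  move: lt le; rewrite /s; case: tpermP => [->|->|/eqP + /eqP +];
  case: tpermP => [->|->|/eqP + /eqP +];
  rewrite -?val_eqE /= => *; split=> //; lia.
by rewrite a'E -[b'](permK w) wb'.
Qed.

End BruhatPattern.

(** * Reduction of involutions by adjacent conjugation *)

Section InvolutionReduction.

Variable m : nat.
Implicit Types (w : 'S_m) (i : 'I_m).

Lemma invol_permK w : (w * w = 1)%g -> involutive w.
Proof. by move=> ww i; rewrite -permM ww perm1. Qed.

(** If [w j > j.+1], then the values of [w] on the interval from [j] to [w j] stay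
    at least [w j]: a drop below [w j] is a descent, hence a 2-cycle on
    consecutive indices, and such a cycle could only be [(j, w j)].  This
    contradicts [w (w j) = j]. *)
Lemma no_descent_adjacent w : (w * w = 1)%g ->
    (forall i i', i' = i.+1 :> nat -> (w i' < w i)%N -> w i = i') ->
  forall i, (w i <= i.+1)%N.
Proof.
move=> /invol_permK wK desc j; rewrite leqNgt; apply/negP => wj.
have above x : (j <= x <= w j)%N -> forall i, i = x :> nat -> (w j <= w i)%N.
  elim: x => [|x IH] xj i ix.
    by have -> : i = j by apply: val_inj => /=; lia.
  have [ij | ij] := eqVneq i j; first by rewrite ij.
  have {}ij : (j < i)%N by move/eqP: ij => /eqP; rewrite -val_eqE /=; lia.
  have xm : (x < m)%N by have := ltn_ord i; lia.
  have wx : (w j <= w (Ordinal xm))%N by apply: IH => //; lia.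
  rewrite leqNgt; apply/negP => wi.
  have E := desc (Ordinal xm) i ix (leq_trans wi wx).
  have wji : w j = i by apply: val_inj => /=; rewrite E in wx; lia.
  by have := congr1 w E; rewrite wK -wji wK => /(congr1 val) /=;
    have := congr1 val wji => /=; lia.
by have := above (w j) _ (w j) erefl; rewrite wK; lia.
Qed.

Lemma ltn_adjacent_tperm i i' a b : i' = i.+1 :> nat -> ~~ ((a == i) && (b == i')) ->
  (a < b)%N -> (tperm i i' a < tperm i i' b)%N.
Proof.
move=> ii'; case: tpermP => [->|->|/eqP + /eqP +];
  case: tpermP => [->|->|/eqP + /eqP +];
  rewrite -?val_eqE /=; lia.
Qed.

(** Removing a descent of [w] on either side increases this sum, which therefore
    measures the progress of the reduction while avoiding the length function. *)
Definition moment w := (\sum_(i < m) i * w i)%N.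

Lemma momentV w : moment (w^-1)%g = moment w.
Proof.
rewrite /moment (reindex_inj (@perm_inj _ w)) /=.
by apply: eq_bigr => i _; rewrite permK mulnC.
Qed.

Lemma ltn_moment w i i' : i' = i.+1 :> nat -> (w i' < w i)%N ->
  (moment w < moment (tperm i i' * w)%g)%N.
Proof.
move=> ii' lt; have ni : i' != i by rewrite -val_eqE /= ii' gtn_eqF.
have split u : moment u =
    (i * u i + (i' * u i' + \sum_(j < m | (j != i) && (j != i')) j * u j))%N.
  by rewrite /moment (bigD1 i) //= (bigD1 i').
rewrite !split !permM tpermL tpermR.
under [X in (_ < _ + (_ + X))%N]eq_bigr => j /andP[ji ji'].
  rewrite permM tpermD 1?eq_sym //; over.
by rewrite ii' !mulSn !addnA ltn_add2r; lia.
Qed.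

Lemma ltn_moment_conj w i i' : (w * w = 1)%g -> i' = i.+1 :> nat ->
    (w i' < w i)%N -> w i != i' ->
  (moment w < moment (tperm i i' * w * tperm i i')%g)%N.
Proof.
move=> ww ii' lt wi; apply: (ltn_trans (ltn_moment ii' lt)).
have wV : (w^-1 = w)%g by apply/eqP; rewrite eq_invg_mul ww.
rewrite -[X in (X < _)%N]momentV -[X in (_ < X)%N]momentV !invMg tpermV wV.
apply: ltn_moment => //; rewrite !permM.
apply: ltn_adjacent_tperm => //; rewrite negb_and wi orbT //.
Qed.

(** Conjugating an involution at a descent that is not one of its own 2-cycles
    removes a descent on both sides; once no such descent remains, the involution
    is a product of disjoint adjacent transpositions. *)
Lemma involution_ind (P : 'S_m -> Prop) :
    (forall w, (w * w = 1)%g -> (forall i, (w i <= i.+1)%N) -> P w) ->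
    (forall w i i', (w * w = 1)%g -> i' = i.+1 :> nat -> (w i < w i')%N ->
       ~ (w i = i /\ w i' = i') -> P w -> P (tperm i i' * w * tperm i i')%g) ->
  forall w, (w * w = 1)%g -> P w.
Proof.
move=> Padj Pstep w ww; have [n] := ubnP (m * (m * m) - moment w).
elim: n w ww => // n IH w ww lt.
have [[i [i' [ii' lti wi]]] | ndesc] := EM (exists i i',
    [/\ i' = i.+1 :> nat, (w i' < w i)%N & w i != i']); last first.
  apply: Padj => //; apply: no_descent_adjacent => // i i' ii' lti.
  by apply/eqP/negPn/negP => wi; apply: ndesc; exists i, i'.
pose s := tperm i i'; pose w' := (s * w * s)%g.
have ss : (s * s = 1)%g by rewrite tperm2.
have -> : w = (s * w' * s)%g by rewrite /w' !mulgA ss mul1g -mulgA ss mulg1.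
have wK := invol_permK ww.
apply: Pstep => //.
- by rewrite /w' !mulgA -(mulgA _ s s) ss mulg1 -(mulgA s w w) ww mulg1.
- rewrite !permM tpermL tpermR; apply: ltn_adjacent_tperm => //.
  by rewrite negb_and wi orbT.
- rewrite !permM tpermL tpermR => -[]; rewrite -[X in _ = X -> _](tpermR i i').
  move=> /perm_inj wi' /(canRL (tpermK i i')); rewrite tpermR => wii.
  by move: lti; rewrite wi' wii ii' ltnNge leqnSn.
apply: IH; first by rewrite /w' !mulgA -(mulgA _ s s) ss mulg1 -(mulgA s w w) ww mulg1.
have := ltn_moment_conj ww ii' lti wi; rewrite -/s -/w'.
suff : (moment w' <= m * (m * m))%N by lia.
rewrite -[X in (X * _)%N]card_ord -sum_nat_const; apply: leq_sum => j _.
by rewrite leq_mul // ltnW.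
Qed.

Lemma l2E w : l2 w = (\sum_(i < m) (i < w i)%N)%N.
Proof. by rewrite /l2 -sum1dep_card big_mkcond; apply: eq_bigr => i _; case: ltnP. Qed.

(** Conjugation by an adjacent transposition could only disturb the excedance
    [i < i'] itself, and [w] does not exchange [i] and [i'] because
    [w i < w i']. *)
Lemma l2_conj w i i' : (w * w = 1)%g -> i' = i.+1 :> nat -> (w i < w i')%N ->
  l2 (tperm i i' * w * tperm i i')%g = l2 w.
Proof.
move=> /invol_permK wK ii' lt; set s := tperm i i'.
rewrite !l2E (reindex_inj (@perm_inj _ s)) /=; apply: eq_bigr => j _.
rewrite !permM tpermK; congr nat_of_bool.
have wi : w i != i' by apply: contraTneq lt => wi; have := wK i; rewrite wi => ->; lia.
have wi' : w i' != i by apply: contraNneq wi => <-; rewrite wK.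
apply/idP/idP; last first.
  apply: ltn_adjacent_tperm => //; apply/negP => /andP[/eqP-> ].
  exact/negP.
move=> /(ltn_adjacent_tperm ii'); rewrite !tpermK; apply.
apply/negP => /andP[/eqP/(canRL (tpermK i i')) jE /eqP/(canRL (tpermK i i')) wjE].
by move: wi'; rewrite tpermL in jE; rewrite tpermR in wjE; rewrite -jE wjE eqxx.
Qed.

End InvolutionReduction.

(** * The class and the cell *)

Section ClassAndCell.

Variables (k : closedFieldType) (n : nat).
Local Notation m := n.+1.
Implicit Types (g h L : 'M[k]_m) (w : 'S_m) (C : set 'M[k]_m).

(** Over an algebraically closed field, an invertible matrix becomes an element of
    [SL] after division by an [m]-th root of its determinant. *)
Lemma SL_class_conj C g h L : is_SL_class C -> C g -> h \in unitmx ->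
  h *m g = L *m h -> C L /\ SL L.
Proof.
move=> [g0 g0S ->] [x xS xg] hU hg.
have dh0 : \det h != 0 by rewrite -unitfE -unitmxE.
have [t tE] : exists t : k, t ^+ m = (\det h)^-1.
  have [t] := @solve_monicpoly k m (fun i => if i == 0 then (\det h)^-1 else 0) isT.
  rewrite big_ord_recl /= expr0 mulr1 big1 ?addr0 => [E|i _]; last by rewrite mul0r.
  by exists t.
have yS : SL (t *: h *m x).
  by rewrite /SL /= det_mulmx detZ tE mulVf // xS mulr1.
have LE : t *: h *m x *m g0 *m invmx (t *: h *m x) = L.
  apply: (canLR (mulmxK (SL_unit yS))); rewrite -xg in hg.
  rewrite -!scalemxAl -scalemxAr mulmxA -hg; congr (_ *: _).
  by rewrite !mulmxA mulmxKV // SL_unit.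
split; first by exists (t *: h *m x).
rewrite -LE /SL /= 2!det_mulmx g0S mulr1 -det_mulmx mulmxV ?det1 //.
exact: SL_unit.
Qed.

Lemma min_rankP g l : reflect (forall c, (l <= \rank (g - c%:M)%R)%N) (l <= min_rank g)%N.
Proof.
apply: (iffP idP); rewrite /min_rank; case: ex_minnP => r /asboolP[c cr] rmin; last first.
  by rewrite -cr.
by move=> lr c'; apply: leq_trans lr (rmin _ _); apply/asboolP; exists c'.
Qed.

(** Replacing the rows and columns outside [T] by those of the identity gives an
    invertible triangular matrix.  It differs from a matrix of rank at most
    [\rank A] by a diagonal one of rank [m - #|T|]. *)
Lemma card_le_rank_triangular (A : 'M[k]_m) (T : {set 'I_m}) :
    {in T &, forall i j : 'I_m, (j < i)%N -> A i j = 0} ->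
    {in T, forall i, A i i != 0} ->
  (#|T| <= \rank A)%N.
Proof.
move=> Atrig Adiag; pose D (X : {set 'I_m}) : 'M[k]_m := \sum_(t in X) delta_mx t t.
have DE X : D X = diag_mx (\row_t (t \in X)%:R).
  rewrite diag_mx_sum_delta /D big_mkcond; apply: eq_bigr => t _.
  by rewrite mxE; case: ifP; rewrite ?scale1r ?scale0r.
have rkD X : (\rank (D X) <= #|X|)%N.
  rewrite -sum1_card /D; elim/big_ind2: _ => [||t _]; rewrite ?mxrank0 ?mxrank_delta //.
  by move=> B b B' b' Bb B'b'; apply: leq_trans (mxrank_add _ _) (leq_add Bb B'b').
pose M := D T *m A *m D T + D (~: T).
have ME i j : M i j =
    if (i \in T) && (j \in T) then A i j else ((i == j) && (i \notin T))%:R.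
  rewrite /M !DE mul_mx_diag mul_diag_mx !mxE !inE.
  have [<-|ij] := eqVneq i j; case: (i \in T); case: (j \in T) => //=;
    rewrite ?(mul0r, mul1r, mulr0, mulr1, addr0, add0r, mulr0n, mulr1n) //.
have MU : M \in unitmx.
  rewrite -unitmx_tr unitmxE det_trig; last first.
    apply/is_trig_mxP => i j ij; rewrite mxE ME.
    case: ifP => [/andP[jT iT]|_]; first exact: Atrig.
    by rewrite -val_eqE /= gtn_eqF.
  rewrite unitfE prodf_seq_neq0; apply/allP => i _; rewrite mxE ME eqxx.
  by case: ifP => [/andP[iT _]|]; [exact: Adiag | case: (i \in T); rewrite //= oner_eq0].
have : (m <= \rank A + #|~: T|)%N.
  rewrite -[m in (m <= _)%N](mxrank_unit MU); apply: leq_trans (mxrank_add _ _) _.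
  by apply: leq_add (rkD _); apply: leq_trans (mxrankM_maxl _ _) (mxrankM_maxr _ _).
by rewrite -{1}[m]card_ord -(cardsC T) leq_add2r.
Qed.

(** The rows and columns kept are those of [T], after the columns have been permuted
    by [w].  The scalar [c] then sits at the places [(w j, j)], which for [j] in [T]
    are above the diagonal. *)
Lemma l2_le_rank w g c : (w * w = 1)%g -> bruhat_cell w g ->
  (l2 w <= \rank (g - c%:M)%R)%N.
Proof.
move=> /invol_permK wK [b1 [d [b2 [b1B [dS dE] b2B ->]]]].
have b2U : b2 \in unitmx by apply: SL_unit; case: b2B.
have [bS bT] := borelM b2B b1B; set b := b2 *m b1 in bS bT.
have -> : \rank (b1 *m d *m b2 - c%:M) = \rank (b *m d - c%:M).
  by rewrite -(@mxrank_conj _ _ b2 (b1 *m d *m b2) (b *m d)) // !mulmxA.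
set A := b *m d - c%:M.
have bd i j : (b *m d) i j = b i (w j) * d (w j) j.
  rewrite mxE (bigD1 (w j)) //= big1 ?addr0 // => l lw.
  by move: (dE l j); rewrite (negbTE lw) => /negbFE/eqP->; rewrite mulr0.
have b0 i : b i i != 0.
  have : b^T \in unitmx by rewrite unitmx_tr SL_unit.
  rewrite unitmxE det_trig; last by apply/is_trig_mxP => x y xy; rewrite mxE bT.
  by rewrite unitfE prodf_seq_neq0 => /allP/(_ i); rewrite mem_index_enum mxE; apply.
pose T := [set t | (w t < t)%N].
have l2T : l2 w = #|T|.
  rewrite /l2 -(card_preimset T (@perm_inj _ w)); apply: eq_card => i.
  by rewrite !inE wK.
have -> : \rank A = \rank (col_perm w A).
  by rewrite col_permE mxrankMfree // row_free_unit unitmx_perm.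
have AE i j : col_perm w A i j = b i j * d j (w j) - c *+ (i == w j).
  by rewrite mxE [LHS]mxE bd wK; congr (_ + _); rewrite !mxE.
rewrite l2T; apply: card_le_rank_triangular => [i j|i]; rewrite !inE => iT.
  move=> jT ji; rewrite AE bT // mul0r sub0r.
  by rewrite -val_eqE /= gtn_eqF ?oppr0 // (ltn_trans jT).
rewrite AE -[_ == w i]val_eqE /= gtn_eqF // subr0.
by rewrite mulf_neq0 // dE wK.
Qed.

Lemma cell_meets_class C g w : is_SL_class C -> C g -> (w * w = 1)%g ->
    (forall c, (l2 w <= \rank (g - c%:M)%R)%N) ->
  exists2 x, C x & bruhat_cell w x.
Proof.
move=> CC Cg ww rkg.
have gU : g \in unitmx.
  by have [_ gS] := SL_class_conj CC Cg (unitmx1 _ _)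
    (etrans (mul1mx g) (esym (mulmx1 g))); apply: SL_unit.
suff [h hU [L hg Lw]] : exists2 h, h \in unitmx &
    exists2 L, h *m g = L *m h & bruhat_pattern w L.
  have [CL LS] := SL_class_conj CC Cg hU hg.
  by exists L => //; apply: bruhat_pattern_cell.
move: w ww rkg; apply: involution_ind => [w ww wS | w i i' ww ii' lt nfix IH] rkg.
  (* [w] prolonged by the identity beyond the range of the indices *)
  pose f j := if insub j is Some x then val (w (x : 'I_m)) else j.
  have fE (x : 'I_m) : f x = w x by rewrite /f valK.
  have fbig j : (m <= j)%N -> f j = j by move=> mj; rewrite /f insubF // ltnNge mj.
  have fK : involutive f.
    move=> j; case: (ltnP j m) => jm; last by rewrite !fbig.
    by rewrite -[j]/(val (Ordinal jm)) !fE invol_permK.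
  have fS j : (f j <= j.+1)%N.
    case: (ltnP j m) => jm; last by rewrite fbig.
    by rewrite -[j]/(val (Ordinal jm)) fE.
  have fm j : (j < m)%N -> (f j < m)%N.
    by move=> jm; rewrite -[j]/(val (Ordinal jm)) fE.
  have [c|h hU [L hg LP]] := @adjacent_involution_form k m f g^T fK fS fm.
    rewrite -tr_scalar_mx -linearB mxrank_tr; apply: leq_trans (rkg c).
    by rewrite l2E; apply: leq_sum => i _; rewrite fE.
  exists (invmx h^T); first by rewrite unitmx_inv unitmx_tr.
  exists L^T; last by move=> i j; rewrite mxE -fE; apply: LP.
  have hTU : h^T \in unitmx by rewrite unitmx_tr.
  have := congr1 trmx hg; rewrite !trmx_mul trmxK => ghL.
  by apply: (canRL (mulmxK _)) => //; rewrite -mulmxA ghL mulKmx.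
have [|h hU [L hg Lw]] := IH; first by move=> c; rewrite -(l2_conj ww ii' lt).
have LU : L \in unitmx.
  by have [_ /SL_unit] := SL_class_conj CC Cg hU hg.
have [h' h'U [L' h'L L'w]] := bruhat_pattern_step ii' lt nfix LU Lw.
exists (h' *m h); first by rewrite unitmx_mul h'U.
by exists L' => //; rewrite -mulmxA hg !mulmxA h'L.
Qed.

End ClassAndCell.

Theorem theorem4p2 (k : closedFieldType) (n : nat) (n_ge1 : (1 <= n)%N)
    (C : set 'M[k]_n.+1) (C_class : is_SL_class C)
    (w : 'S_n.+1) (w_inv : (w * w = 1)%g) :
  (C `&` bruhat_cell w !=set0)%classic <-> (l2 w <= class_l C)%N.
Proof.
have half : (l2 w <= n.+1./2)%N.
  by rewrite geq_half_double l2E; apply/excedances_le_half/invol_permK.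
have rE g : C g -> (l2 w <= class_l C)%N = (l2 w <= min_rank g)%N.
  by move=> Cg; rewrite /class_l (class_rE C_class Cg) leq_min half andbT.
split=> [[x [Cx xw]] | lw].
  by rewrite (rE x Cx); apply/min_rankP => c; apply: l2_le_rank.
have [g Cg] : exists g, C g.
  case: (C_class) => g gS ->; exists g; exists 1%:M; first by rewrite /SL /= det1.
  by rewrite invmx1 mulmx1 mul1mx.
have [|x Cx xw] := cell_meets_class C_class Cg w_inv; last by exists x.
by apply/min_rankP; rewrite -(rE g Cg).
Qed.
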